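(* Let $\mathcal{C}$ be a pointed finitely complete category such that the full subcategory $\mathsf{P}(\mathcal{C})$ of protomodular objects is closed under finite limits in $\mathcal{C}$. Let $\mathcal{P}$ be the class of those points in $\mathcal{C}$ that are pullbacks (along arbitrary morphisms of $\mathcal{C}$) of some point in $\mathsf{P}(\mathcal{C})$. Then $\mathsf{P}(\mathcal{C})$ coincides with the protomodular core $\mathcal{P}(\mathcal{C})$ consisting of the $\mathcal{P}$-special objects of $\mathcal{C}$.
   Context: A pair of morphisms with common codomain $A$ is jointly strongly epimorphic if every monomorphism into $A$ through which both factor is an isomorphism. A point over $B$ is a pair $(f\colon A\to B,\ s\colon B\to A)$ with $fs=1_B$. Given $g\colon C\to B$, form the pullback $C\times_BA$ with projections $\pi_C,\pi_A$; the pullback of $(f,s)$ along $g$ is the point $(\pi_C,\langle 1_C,sg\rangle)$. The point $(f,s)$ is strong if for every $g\colon C\to B$ the pair $(\pi_A,s)$ is jointly strongly epimorphic; it is stably strong if its pullback along every morphism with codomain $B$ is strong. An object $Y$ is protomodular if every point over $Y$ is stably strong; $\mathsf{P}(\mathcal{C})$ is the full subcategory of protomodular objects. A point $(f\colon A\to X,s)$ of $\mathcal{C}$ belongs to $\mathcal{P}$ iff there exist a point $(f'\colon A'\to X',s')$ with $A',X'\in\mathsf{P}(\mathcal{C})$ and a morphism $h\colon X\to X'$ of $\mathcal{C}$ such that $(f,s)$ is (up to isomorphism) the pullback of $(f',s')$ along $h$. For a class $\mathcal{S}$ of points, an object $X$ is $\mathcal{S}$-special if the point $(\pi_1\colon X\times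 X\to X,\ \langle 1_X,1_X\rangle\colon X\to X\times X)$ belongs to $\mathcal{S}$ (equivalently, if $(\pi_2,\langle 1_X,1_X\rangle)$ belongs to $\mathcal{S}$); $\mathcal{S}(\mathcal{C})$ denotes the full subcategory of $\mathcal{S}$-special objects. Here ''the protomodular core $\mathcal{P}(\mathcal{C})$ of $\mathcal{C}$ relative to $\mathcal{P}$'' is just the name of this full subcategory of $\mathcal{P}$-special objects. *)

(* Defs.v *)
From Stdlib Require Import List FinFun.

Set Implicit Arguments.
Unset Strict Implicit.
Unset Printing Implicit Defensive.

Record Category := {
  Ob :> Type;
  Hom : Ob -> Ob -> Type;
  id : forall X, Hom X X;
  comp : forall X Y Z, Hom Y Z -> Hom X Y -> Hom X Z;
  comp_id_l : forall X Y (f : Hom X Y), comp (id Y) f = f;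
  comp_id_r : forall X Y (f : Hom X Y), comp f (id X) = f;
  comp_assoc : forall W X Y Z (h : Hom Y Z) (g : Hom X Y) (f : Hom W X),
    comp h (comp g f) = comp (comp h g) f
}.

Arguments Hom {c} _ _.
Arguments id {c} _.
Arguments comp {c X Y Z} _ _.

Declare Scope cat_scope.
Delimit Scope cat_scope with cat.
Open Scope cat_scope.

Notation "g ∘ f" := (comp g f) (at level 40, left associativity) : cat_scope.

Definition IsMono (C : Category) (X Y : C) (m : Hom X Y) : Prop :=
  forall (Z : C) (u v : Hom Z X), m ∘ u = m ∘ v -> u = v.

Definition IsIso (C : Category) (X Y : C) (f : Hom X Y) : Prop :=
  exists g : Hom Y X, g ∘ f = id X /\ f ∘ g = id Y.

Definition IsTerminal (C : Category) (T : C) : Prop :=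
  forall X : C, exists! f : Hom X T, True.

Definition IsInitial (C : Category) (I : C) : Prop :=
  forall X : C, exists! f : Hom I X, True.

Definition Pointed (C : Category) : Prop :=
  exists Z : C, IsInitial Z /\ IsTerminal Z.

Record Functor (J C : Category) := {
  fobj :> J -> C;
  fmap : forall i j : J, Hom i j -> Hom (fobj i) (fobj j);
  fmap_id : forall i : J, fmap (id i) = id (fobj i);
  fmap_comp : forall (i j k : J) (v : Hom j k) (u : Hom i j),
    fmap (v ∘ u) = fmap v ∘ fmap u
}.

Arguments fmap {J C} _ {i j} _.

Record Cone (J C : Category) (F : Functor J C) := {
  apex : C;
  leg : forall j : J, Hom apex (F j);
  leg_natural : forall (i j : J) (u : Hom i j), fmap F u ∘ leg i = leg j
}.

Arguments leg {J C F} _ _.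

Definition IsLimit (J C : Category) (F : Functor J C) (L : Cone F) : Prop :=
  forall K : Cone F, exists! u : Hom (apex K) (apex L),
    forall j : J, leg L j ∘ u = leg K j.

Definition FiniteCategory (J : Category) : Prop :=
  Finite J /\ forall i j : J, Finite (Hom i j).

Definition FinitelyComplete (C : Category) : Prop :=
  forall (J : Category) (F : Functor J C),
    FiniteCategory J -> exists L : Cone F, IsLimit L.

(* A full subcategory is given by its class of objects. *)
Definition FullSubcategory (C : Category) : Type := C -> Prop.

(* Any limit cone in the ambient category is allowed, so this includes
   closure under isomorphism. *)
Definition ClosedUnderFiniteLimits (C : Category) (S : FullSubcategory C)
  : Prop :=
  forall (J : Category) (F : Functor J C) (L : Cone F),
    FiniteCategory J -> (forall j : J, S (F j)) -> IsLimit L -> S (apex L).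

(*     P --p--> A
       |        |
       q        f
       v        v
       D --g--> B     *)
Definition IsPullback (C : Category) (A B D P : C)
  (f : Hom A B) (g : Hom D B) (p : Hom P A) (q : Hom P D) : Prop :=
  f ∘ p = g ∘ q /\
  forall (T : C) (a : Hom T A) (d : Hom T D), f ∘ a = g ∘ d ->
    exists! u : Hom T P, p ∘ u = a /\ q ∘ u = d.

Definition IsProduct (C : Category) (X Y P : C)
  (p : Hom P X) (q : Hom P Y) : Prop :=
  forall (T : C) (x : Hom T X) (y : Hom T Y),
    exists! u : Hom T P, p ∘ u = x /\ q ∘ u = y.

Definition JointlyStronglyEpic (C : Category) (X Y A : C)
  (f : Hom X A) (g : Hom Y A) : Prop :=
  forall (M : C) (m : Hom M A), IsMono m ->
    (exists f' : Hom X M, m ∘ f' = f) ->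
    (exists g' : Hom Y M, m ∘ g' = g) ->
    IsIso m.

Record Point (C : Category) (B : C) := {
  total : C;
  proj : Hom total B;
  sec : Hom B total;
  proj_sec : proj ∘ sec = id B
}.

(* [q] is, up to isomorphism, the pullback of the point [p] along [g], with
   [t] the projection to [total p].  As [proj q ∘ sec q = id], the second
   equation says that [sec q] is the induced morphism <1, sec p ∘ g>. *)
Definition IsPullbackPoint (C : Category) (B D : C) (g : Hom D B)
  (p : Point B) (q : Point D) (t : Hom (total q) (total p)) : Prop :=
  IsPullback (proj p) g t (proj q) /\ t ∘ sec q = sec p ∘ g.

Arguments IsPullbackPoint {C B D} g p q t.

(* Pullbacks are not chosen: "the pullback" is rendered by quantifying over
   all pullback squares. *)
Definition Strong (C : Category) (B : C) (p : Point B) : Prop :=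
  forall (D P : C) (g : Hom D B) (piA : Hom P (total p)) (piD : Hom P D),
    IsPullback (proj p) g piA piD -> JointlyStronglyEpic piA (sec p).

Definition StablyStrong (C : Category) (B : C) (p : Point B) : Prop :=
  forall (D : C) (g : Hom D B) (q : Point D) (t : Hom (total q) (total p)),
    IsPullbackPoint g p q t -> Strong q.

Definition Protomodular (C : Category) : FullSubcategory C :=
  fun Y => forall p : Point Y, StablyStrong p.

Definition PointClass (C : Category) : Type := forall B : C, Point B -> Prop.

(* [p] is of the form (pi_1 : X × X -> X, <1, 1>), for the product cone
   consisting of [proj p] and [pi2]. *)
Definition IsDiagonalPoint (C : Category) (X : C) (p : Point X)
  (pi2 : Hom (total p) X) : Prop :=
  IsProduct (proj p) pi2 /\ pi2 ∘ sec p = id X.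

Arguments IsDiagonalPoint {C X} p pi2.

(* Like pullbacks, products are not chosen. *)
Definition Special (C : Category) (S : PointClass C) : FullSubcategory C :=
  fun X => forall (p : Point X) (pi2 : Hom (total p) X),
    IsDiagonalPoint p pi2 -> S X p.

Definition PullbackOfProtomodular (C : Category) : PointClass C :=
  fun X p =>
    exists (X' : C) (p' : Point X') (h : Hom X X')
           (t : Hom (total p) (total p')),
      Protomodular (total p') /\ Protomodular X' /\ IsPullbackPoint h p' p t.

Definition ProtomodularCore (C : Category) : FullSubcategory C :=
  Special (@PullbackOfProtomodular C).

(* Main.v *)
(** If [X] is [P]-special, then [X], being the kernel of the first projection
    [X × X -> X], is also the kernel of the point between protomodular objects
    of which the diagonal point is a pullback.  A kernel is a finite limit, and
    so is the zero object, hence [X] is protomodular.  Conversely, [X × X] is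
    protomodular when [X] is, and a point is its own pullback along the
    identity. *)
Require Import Defs.
From Stdlib Require Import List FinFun.

Set Implicit Arguments.
Unset Strict Implicit.
Unset Printing Implicit Defensive.

(** * Finite diagram shapes: the empty category and the cospan *)

Definition empty_category : Category.
Proof.
  refine {| Ob := Empty_set; Hom := fun _ _ => Empty_set;
            id := fun i => match i with end;
            comp := fun i _ _ _ _ => match i with end |}; intros [].
Defined.

Definition empty_functor (C : Category) : Functor empty_category C.
Proof.
  refine (@Build_Functor empty_category C
            (fun i => match i with end) (fun i => match i with end) _ _);
    intros [].
Defined.

(** This cone is a limit exactly when [T] is terminal. *)
Definition empty_cone (C : Category) (T : C) : Cone (empty_functor C).
Proof.
  refine (@Build_Cone _ _ (empty_functor C) T (fun i => match i with end) _);
    intros [].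
Defined.

Inductive cospan_ob := cospan_left | cospan_right | cospan_base.

(** Each hom-set is [unit] or empty, so the shape is a preorder and its laws hold by case
    analysis. *)
Definition cospan_hom (i j : cospan_ob) : Set :=
  match i, j with
  | cospan_left, cospan_left | cospan_right, cospan_right
  | _, cospan_base => unit
  | _, _ => Empty_set
  end.

Definition cospan_id (i : cospan_ob) : cospan_hom i i :=
  match i with
  | cospan_left | cospan_right | cospan_base => tt
  end.

Definition cospan_comp (i j k : cospan_ob) :
  cospan_hom j k -> cospan_hom i j -> cospan_hom i k.
Proof. destruct i, j, k; simpl; intros [] []; exact tt. Defined.

Definition cospan_category : Category.
Proof.
  refine {| Ob := cospan_ob; Hom := cospan_hom;
            id := cospan_id; comp := cospan_comp |}.
  - intros [] [] []; reflexivity.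
  - intros [] [] []; reflexivity.
  - intros [] [] [] [] [] [] []; reflexivity.
Defined.

Lemma empty_category_finite : FiniteCategory empty_category.
Proof. split; [exists nil; intros [] | intros []]. Qed.

Lemma cospan_category_finite : FiniteCategory cospan_category.
Proof.
  split.
  - exists (cospan_left :: cospan_right :: cospan_base :: nil).
    intros []; simpl; tauto.
  - intros [] []; solve [exists (tt :: nil); intros []; simpl; tauto
                        | exists nil; intros []].
Qed.

(** * Pullbacks as limits of cospans *)

Section Cospans.

Variables (C : Category) (A B D : C) (f : Hom A B) (g : Hom D B).

Definition cospan_fobj (i : cospan_category) : C :=
  match i with
  | cospan_left => A
  | cospan_right => D
  | cospan_base => B
  end.

Definition cospan_fmap (i j : cospan_category) :
  Hom i j -> Hom (cospan_fobj i) (cospan_fobj j) :=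
  match i, j return cospan_hom i j -> Hom (cospan_fobj i) (cospan_fobj j) with
  | cospan_left, cospan_left => fun _ => id A
  | cospan_right, cospan_right => fun _ => id D
  | cospan_base, cospan_base => fun _ => id B
  | cospan_left, cospan_base => fun _ => f
  | cospan_right, cospan_base => fun _ => g
  | _, _ => fun u => match u with end
  end.

Definition cospan_functor : Functor cospan_category C.
Proof.
  refine (@Build_Functor cospan_category C cospan_fobj cospan_fmap _ _).
  - intros []; reflexivity.
  - intros [] [] [] [] []; simpl; rewrite ?comp_id_l, ?comp_id_r; reflexivity.
Defined.

(** Naturality forces the leg to the base; of its two equal forms [f ∘ p] and [g ∘ q], the first is
    taken. *)
Definition cospan_leg (P : C) (p : Hom P A) (q : Hom P D) (i : cospan_ob) :
  Hom P (cospan_functor i) :=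
  match i return Hom P (cospan_functor i) with
  | cospan_left => p
  | cospan_right => q
  | cospan_base => f ∘ p
  end.

Definition cospan_cone (P : C) (p : Hom P A) (q : Hom P D)
  (e : f ∘ p = g ∘ q) : Cone cospan_functor.
Proof.
  refine (@Build_Cone _ _ cospan_functor P (cospan_leg p q) _).
  (* The arrow from the right vertex to the base is the case that needs [e]. *)
  intros [] [] []; simpl; rewrite ?comp_id_l; congruence.
Defined.

Lemma cospan_cone_commutes (K : Cone cospan_functor) :
  f ∘ leg K cospan_left = g ∘ leg K cospan_right.
Proof.
  transitivity (leg K cospan_base).
  - exact (@leg_natural _ _ _ K cospan_left cospan_base tt).
  - symmetry. exact (@leg_natural _ _ _ K cospan_right cospan_base tt).
Qed.

(** A cone over the cospan is determined by its legs to [A] and [D], so the two universal properties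
    agree. *)
Lemma pullback_limit (P : C) (p : Hom P A) (q : Hom P D) (e : f ∘ p = g ∘ q) :
  IsPullback f g p q -> IsLimit (cospan_cone e).
Proof.
  intros [_ universal] K.
  destruct (universal _ _ _ (cospan_cone_commutes K)) as [u [[pu qu] unique_u]].
  exists u; split.
  - intros []; simpl; [exact pu | exact qu |].
    rewrite <- comp_assoc, pu.
    exact (@leg_natural _ _ _ K cospan_left cospan_base tt).
  - intros v legs_v. apply unique_u. split.
    + exact (legs_v cospan_left).
    + exact (legs_v cospan_right).
Qed.

Lemma limit_pullback (L : Cone cospan_functor) :
  IsLimit L -> IsPullback f g (leg L cospan_left) (leg L cospan_right).
Proof.
  intros limit_L. split; [apply cospan_cone_commutes |].
  intros T a d e.
  destruct (limit_L (cospan_cone e)) as [u [legs_u unique_u]].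
  exists u; split.
  - split; [exact (legs_u cospan_left) | exact (legs_u cospan_right)].
  - intros v [pv qv]. apply unique_u. intros []; simpl; [exact pv | exact qv |].
    rewrite <- pv, comp_assoc. f_equal. symmetry.
    exact (@leg_natural _ _ _ L cospan_left cospan_base tt).
Qed.

Lemma pullback_exists : FinitelyComplete C ->
  exists (P : C) (p : Hom P A) (q : Hom P D), IsPullback f g p q.
Proof.
  intros complete.
  destruct (complete _ cospan_functor cospan_category_finite) as [L limit_L].
  exists (apex L), (leg L cospan_left), (leg L cospan_right).
  exact (limit_pullback limit_L).
Qed.

(** Closure concerns every limit cone, so it applies to any pullback square once the square is read
    as a cone. *)
Lemma closed_pullback (S : FullSubcategory C) (P : C) (p : Hom P A)
  (q : Hom P D) :
  ClosedUnderFiniteLimits S -> S A -> S B -> S D -> IsPullback f g p q -> S P.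
Proof.
  intros closed SA SB SD pb.
  apply (closed _ _ (cospan_cone (proj1 pb)) cospan_category_finite).
  - intros []; assumption.
  - exact (pullback_limit (proj1 pb) pb).
Qed.

End Cospans.

(** * Terminal objects, products and pasting of pullbacks *)

Lemma closed_terminal (C : Category) (S : FullSubcategory C) (T : C) :
  ClosedUnderFiniteLimits S -> IsTerminal T -> S T.
Proof.
  intros closed terminal_T.
  apply (closed _ _ (empty_cone T) empty_category_finite); [intros [] |].
  intros K. destruct (terminal_T (apex K)) as [u [_ unique_u]].
  exists u; split; [intros [] | intros v _; exact (unique_u v I)].
Qed.

Lemma terminal_eq (C : Category) (T X : C) (u v : Hom X T) :
  IsTerminal T -> u = v.
Proof.
  intros terminal_T. destruct (terminal_T X) as [w [_ unique_w]].
  rewrite <- (unique_w u I). exact (unique_w v I).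
Qed.

(** Squares over a terminal object always commute. Binary products thus become limits of cospans, to
    which closure applies. *)
Lemma pullback_terminal_product (C : Category) (T X Y P : C) (f : Hom X T)
  (g : Hom Y T) (p : Hom P X) (q : Hom P Y) :
  IsTerminal T -> IsPullback f g p q <-> IsProduct p q.
Proof.
  intros terminal_T. split.
  - intros [_ universal] U x y. apply universal. now apply terminal_eq.
  - intros product. split; [now apply terminal_eq |].
    intros U x y _. apply product.
Qed.

Lemma pullback_id (C : Category) (A B : C) (f : Hom A B) :
  IsPullback f (id B) (id A) f.
Proof.
  split; [now rewrite comp_id_l, comp_id_r |].
  intros T a d e. rewrite comp_id_l in e. exists a. split.
  - split; [apply comp_id_l | exact e].
  - intros v [av _]. now rewrite comp_id_l in av.
Qed.

Lemma pullback_paste (C : Category) (A B D E P Q : C) (f : Hom A B)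
  (g : Hom D B) (h : Hom E D) (p : Hom P A) (q : Hom P D) (r : Hom Q P)
  (s : Hom Q E) :
  IsPullback f g p q -> IsPullback q h r s -> IsPullback f (g ∘ h) (p ∘ r) s.
Proof.
  intros [fp universal_P] [qr universal_Q]. split.
  - now rewrite comp_assoc, fp, <- !comp_assoc, qr.
  - intros T a e fa. rewrite <- comp_assoc in fa.
    (* The mediating map is built in two stages, first into [P] and then into [Q]. *)
    destruct (universal_P T a (h ∘ e) fa) as [u [[pu qu] unique_u]].
    destruct (universal_Q T u e qu) as [v [[rv sv] unique_v]].
    exists v. split.
    + split; [now rewrite <- comp_assoc, rv | exact sv].
    + intros w [prw sw]. apply unique_v. split; [| exact sw].
      (* A competitor [w] gives [r ∘ w], which has the components that determine [u]. *)
      symmetry. apply unique_u. split; [now rewrite comp_assoc |].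
      now rewrite comp_assoc, qr, <- comp_assoc, sw.
Qed.

(** The fibre of [p] over the point [z] is a copy of [Y]: a map [a] into it has constant first
    component, so [q ∘ a] determines it. *)
Lemma kernel_of_projection (C : Category) (Z X Y P : C) (p : Hom P X)
  (q : Hom P Y) (z : Hom Z X) (k : Hom Y P) (y : Hom Y Z) :
  IsTerminal Z -> IsProduct p q -> p ∘ k = z ∘ y -> q ∘ k = id Y ->
  IsPullback p z k y.
Proof.
  intros terminal_Z product pk qk. split; [exact pk |].
  intros T a d pa. exists (q ∘ a). split.
  - split; [| now apply terminal_eq].
    (* Both [k ∘ (q ∘ a)] and [a] have the components [p ∘ a] and [q ∘ a], hence they are equal. *)
    destruct (product T (p ∘ a) (q ∘ a)) as [u [_ unique_u]].
    transitivity u; [symmetry |]; apply unique_u.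
    + split; [| now rewrite comp_assoc, qk, comp_id_l].
      rewrite pa, comp_assoc, pk, <- comp_assoc. f_equal.
      now apply terminal_eq.
    + split; reflexivity.
  - intros v [kv _]. now rewrite <- kv, comp_assoc, qk, comp_id_l.
Qed.

(** [Special] quantifies over all diagonal points, so one must exist before it yields anything. The
    product is built as a pullback over the zero object. *)
Lemma diagonal_point_exists (C : Category) (X : C) :
  Pointed C -> FinitelyComplete C ->
  exists (p : Point X) (pi2 : Hom (total p) X), IsDiagonalPoint p pi2.
Proof.
  intros [Z [_ terminal_Z]] complete.
  destruct (terminal_Z X) as [x _].
  destruct (pullback_exists x x complete) as [P [p [q pb]]].
  assert (product : IsProduct p q)
    by exact (proj1 (pullback_terminal_product x x p q terminal_Z) pb).
  destruct (product X (id X) (id X)) as [d [[pd qd] _]].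
  exists (Build_Point pd), q. split; assumption.
Qed.

Theorem proposition7p15 (C : Category) (C_pointed : Pointed C)
  (C_complete : FinitelyComplete C)
  (P_closed : ClosedUnderFiniteLimits (@Protomodular C)) :
  forall X : C, Protomodular X <-> ProtomodularCore X.
Proof.
  intros X. split.
  - intros PX p pi2 [product _].
    destruct C_pointed as [Z [_ terminal_Z]].
    destruct (terminal_Z X) as [x _].
    exists X, p, (id X), (id (total p)). split; [| split].
    (* [total p] is [X × X], the pullback of [X] with itself over the zero object. *)
    + apply (closed_pullback (f := x) (g := x) (p := proj p) (q := pi2)
               P_closed); try exact PX.
      * exact (closed_terminal P_closed terminal_Z).
      * now apply pullback_terminal_product.
    + exact PX.
    + split; [apply pullback_id | now rewrite comp_id_l, comp_id_r].
  - intros core_X.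
    destruct (diagonal_point_exists X C_pointed C_complete)
      as [p [pi2 diagonal]].
    destruct (core_X p pi2 diagonal) as [X' [p' [h [t [PA [PX' [pb _]]]]]]].
    destruct diagonal as [product _].
    destruct C_pointed as [Z [initial_Z terminal_Z]].
    destruct (initial_Z X) as [z _].
    destruct (terminal_Z X) as [x _].
    (* [z ∘ x] is the zero map, so [k] is [<0, 1>], the kernel of the first projection. *)
    destruct (product X (z ∘ x) (id X)) as [k [[pk qk] _]].
    (* Pasting presents [X] as the pullback of [proj p'] along [h ∘ z], that is, as the kernel of
       [proj p']. All three objects of this cospan are protomodular. *)
    apply (closed_pullback P_closed PA PX'
             (closed_terminal P_closed terminal_Z)
             (pullback_paste pb
                (kernel_of_projection terminal_Z product pk qk))).
Qed.
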